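(* Consider $\mathcal{R}$-Wythoff, whose moves are of the following types, for each positive integer $k$: type $L_k$, remove $k$ tokens from the larger pile (or from either pile if the piles are equal); and type $D_k$, remove $k$ tokens from both piles. For every nonempty set $T$ of these move types, the game obtained from $\mathcal{R}$-Wythoff by forbidding all moves of types in $T$ (from every position) does not have the same set of $\mathcal{P}$-positions as $\mathcal{R}$-Wythoff. Equivalently, no restriction of $\mathcal{R}$-Wythoff preserves its $\mathcal{P}$-positions.
   Context: A position is an unordered pair $(a,b)$ of nonnegative integers (pile sizes). Two players alternate; the player making the last move wins. $\mathcal{R}$-Wythoff: a move either removes a positive number of tokens from the larger pile (or from either pile if both piles have equal size), or removes the same positive number of tokens from both piles. A $\mathcal{P}$-position is a position from which the player about to move cannot force a win. The $\mathcal{P}$-positions of $\mathcal{R}$-Wythoff are $\{(\lfloor \phi n\rfloor, \lfloor \phi n\rfloor+n): n\ge 0\}$ with $\phi=(1+\sqrt5)/2$. A restriction of a game is a game obtained by eliminating some of its moves. *)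

(* Defs.v *)
From HB Require Import structures.
From mathcomp Require Import all_boot.
From mathcomp Require Import boolp classical_sets.

Set Implicit Arguments.
Unset Strict Implicit.
Unset Printing Implicit Defensive.

Local Open Scope classical_set_scope.

(* Normal play: the player making the last move wins.  Being inductive, this
   says that the player to move has a strategy winning in finitely many moves,
   so a player who cannot move loses. *)
Inductive can_force_win (X : Type) (move : X -> X -> Prop) (p : X) : Prop :=
| Can_force_win q of move p q
    & (forall r, move q r -> can_force_win move r).

Definition P_positions (X : Type) (move : X -> X -> Prop) : set X :=
  [set p | ~ can_force_win move p].

(* An unordered pair of naturals is encoded by its sorted representative. *)
Record position := Position { piles : nat * nat; _ : piles.1 <= piles.2 }.

HB.instance Definition _ := [isSub for piles].
HB.instance Definition _ := [Equality of position by <:].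

Lemma position_of_subproof (a b : nat) :
  (minn a b, maxn a b).1 <= (minn a b, maxn a b).2.
Proof. by rewrite /= geq_min leq_maxl. Qed.

Definition position_of (a b : nat) : position :=
  Position (position_of_subproof a b).

Lemma position_ofC (a b : nat) : position_of a b = position_of b a.
Proof. by apply: val_inj; rewrite /= minnC maxnC. Qed.

Definition posint := {k : nat | 0 < k}.

Inductive move_type := L_type of posint | D_type of posint.

(* Since [position_of] is symmetric, the condition [b <= a] only names the
   larger pile [a]; when [a = b] it allows removal from either pile. *)
Variant move_of_type : move_type -> position -> position -> Prop :=
| L_move (k : posint) (a b : nat) of b <= a & val k <= a :
    move_of_type (L_type k) (position_of a b) (position_of (a - val k) b)
| D_move (k : posint) (a b : nat) of val k <= a & val k <= b :
    move_of_type (D_type k) (position_of a b)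
      (position_of (a - val k) (b - val k)).

Definition R_Wythoff (p q : position) : Prop :=
  exists t, move_of_type t p q.

Definition R_Wythoff_forbidding (T : set move_type) (p q : position) : Prop :=
  exists2 t, ~ T t & move_of_type t p q.

(* Main.v *)
(* Each move type t is the only one that wins from some position, so it cannot
   be forbidden.  For L_k this position is (0,k).  For D_k it is (k,k), unless
   some (i,k) with i < k is a P-position, and then it is (k+1,k+2), from which
   D_k leads to (1,2).  The latter uses that two consecutive integers k, k+1
   are never both the larger pile of a P-position, because the P-positions
   (a,b) with a <= b have b - a strictly increasing in a. *)

Require Import Defs.
From mathcomp Require Import all_boot.
From mathcomp Require Import boolp classical_sets.
From mathcomp Require Import zify.

Local Open Scope classical_set_scope.

(** Induction on the strategy: if its first option [q] also won, some option [r] of [q] would have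
    only winning options, contrary to the induction hypothesis for [r]. *)
Lemma can_force_win_not_all (X : Type) (move : X -> X -> Prop) p :
  can_force_win move p -> ~ (forall q, move p q -> can_force_win move q).
Proof.
elim=> {}p q pq _ IH allp.
by have [r qr allr] := allp q pq; exact: IH qr allr.
Qed.

Lemma can_force_win_move (X : Type) (move : X -> X -> Prop) p :
  can_force_win move p -> exists2 q, move p q & P_positions move q.
Proof.
case=> q pq allq; exists q => // Wq; exact: can_force_win_not_all Wq allq.
Qed.

(** If [q] were not winning, then by induction on [size] all its options would win, and moving to
    [q] would win from [p]. *)
Lemma P_positions_move (X : Type) (move : X -> X -> Prop)
  (size : X -> nat) p q :
  (forall x y, move x y -> size y < size x) ->
  P_positions move p -> move p q -> can_force_win move q.
Proof.
move=> size_move; have [n] := ubnP (size p).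
elim: n p q => // n IH p q pn Pp pq; apply: contrapT => Pq; apply: Pp.
by exists q => // r; apply: IH Pq; apply: leq_trans (size_move _ _ pq) _.
Qed.

Lemma position_of_eq a b c d : position_of a b = position_of c d ->
  (a = c /\ b = d) \/ (a = d /\ b = c).
Proof. by move=> /(congr1 val)[]; lia. Qed.

Lemma move_of_typeP t x y q : x <= y -> move_of_type t (position_of x y) q ->
  (exists k : posint,
     [/\ t = L_type k, val k <= y & q = position_of x (y - val k)])
  \/
  (exists k : posint,
     [/\ t = D_type k, val k <= x & q = position_of (x - val k) (y - val k)]).
Proof.
move=> xy mv; move E: (position_of x y) mv => p mv.
case: mv E => k a b h1 h2 /position_of_eq E; [left|right]; exists k.
  have [-> ->] : x = b /\ y = a by lia.
  by split=> //; rewrite position_ofC.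
case: E => [[-> ->]|[-> ->]]; split=> //.
exact: position_ofC.
Qed.

Lemma R_Wythoff_lt p q : R_Wythoff p q ->
  (piles q).1 + (piles q).2 < (piles p).1 + (piles p).2.
Proof.
move=> [t]; case=> k a b; have := valP k; rewrite /=; lia.
Qed.

Definition losing a b := P_positions R_Wythoff (position_of a b).

Lemma losingC a b : losing a b -> losing b a.
Proof. by rewrite /losing position_ofC. Qed.

Lemma losing_move p q :
  P_positions R_Wythoff p -> R_Wythoff p q -> ~ P_positions R_Wythoff q.
Proof.
by move=> Pp pq; apply; exact: (P_positions_move _ _ _ _ _ R_Wythoff_lt Pp pq).
Qed.

Lemma losing_L x y c : x <= y -> c < y -> losing x y -> ~ losing x c.
Proof.
move=> xy cy Pxy; apply: (losing_move _ _ Pxy).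
have k0 : 0 < y - c by rewrite subn_gt0.
pose k : posint := exist _ (y - c) k0; exists (L_type k).
rewrite (position_ofC x y) (position_ofC x c).
rewrite -[in position_of c _](subKn (ltnW cy)); apply: (@L_move k) => //=.
exact: leq_subr.
Qed.

Lemma losing_D a b j : 0 < j -> losing (a + j) (b + j) -> ~ losing a b.
Proof.
move=> j0 Pab; apply: (losing_move _ _ Pab).
pose k : posint := exist _ j j0; exists (D_type k).
rewrite -[in position_of a _](addnK j a) -[in position_of _ b](addnK j b).
by apply: (@D_move k) => /=; exact: leq_addl.
Qed.

Lemma not_losing x y : x <= y -> ~ losing x y ->
  (exists2 c, c < y & losing x c) \/
  (exists a b j, [/\ 0 < j, a + j = x, b + j = y & losing a b]).
Proof.
move=> xy /contrapT W; have [q [t mv] Pq] := can_force_win_move _ _ _ W.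
have [[k [_ ky Eq]]|[k [_ kx Eq]]] := move_of_typeP _ _ _ _ xy mv.
  left; exists (y - val k); last by rewrite /losing -Eq.
  by have k0 : 0 < val k := valP k; lia.
right; exists (x - val k), (y - val k), (val k).
by split; [exact: valP | lia | lia | rewrite /losing -Eq].
Qed.

Lemma losing00 : losing 0 0.
Proof.
apply: contrapT => /(not_losing _ _ (leqnn 0))[[c]|[a [b [j []]]]]; lia.
Qed.

Lemma not_losing0n n : 0 < n -> ~ losing 0 n.
Proof. by move=> n0 /(losing_L _ _ _ (leq0n n) n0); apply; exact: losing00. Qed.

Lemma not_losingnn n : 0 < n -> ~ losing n n.
Proof. by move=> n0 /(losing_D 0 0 _ n0); apply; exact: losing00. Qed.

(** Every option is [(0, 1)] or [(1, 1)], one move away from [(0, 0)]. *)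
Lemma losing12 : losing 1 2.
Proof.
apply: contrapT => /(not_losing 1 2 isT)[[c c2]|[a [b [j [j0 aj bj]]]]].
  have [->|->] : c = 0 \/ c = 1 by lia.
    by move=> /losingC; exact: not_losing0n.
  exact: not_losingnn.
have [-> ->] : a = 0 /\ b = 1 by lia.
exact: not_losing0n.
Qed.

(* Otherwise consider (a, a+e), where e is the smaller difference b' - a': it
   reaches a P-position neither by an L-move, which (a,b) could also reach, nor
   by a D-move, which (a',b') could also reach.  Hence it is itself a
   P-position, and (a,b) or (a',b') reaches it. *)
Lemma losing_diff_lt a b a' b' : a <= b -> a' <= b' -> losing a b ->
  losing a' b' -> a < a' -> b - a < b' - a'.
Proof.
move=> ab ab' P P' aa'; rewrite ltnNge; apply/negP => le_diff.
have noD i j : i < a' -> j + a' = i + b' -> ~ losing i j.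
  move=> ia' e; apply: (losing_D _ _ (a' - i)); first by lia.
  by have [-> ->] : i + (a' - i) = a' /\ j + (a' - i) = b' by lia.
have Na : ~ losing a (a + (b' - a')) by apply: noD; lia.
have [[c c_lt]|[i [j [k [k0 ik jk]]]]] := not_losing _ _ (leq_addr _ a) Na.
  by apply: losing_L P; lia.
by apply: noD; lia.
Qed.

(** Unequal smaller piles would violate the strict growth of differences, since the larger piles
    differ by only one; if [i = j], an L-move joins the two positions. *)
Lemma losing_larger_succ i j k : i <= k -> j <= k ->
  losing i k -> ~ losing j k.+1.
Proof.
move=> ik jk P P'; have [ij|ji|e] := ltngtP i j.
- by have := losing_diff_lt _ _ _ _ ik (leqW jk) P P' ij; lia.
- by have := losing_diff_lt _ _ _ _ (leqW jk) ik P' P ji; lia.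
- by move: P' P; rewrite -e; apply: losing_L; lia.
Qed.

(** With unchanged P-positions, [p] would keep an allowed move to one of them, but such a move has
    the forbidden type [t]. *)
Lemma forbidding_neq (T : set move_type) t p : T t -> ~ P_positions R_Wythoff p ->
  (forall t' q, move_of_type t' p q -> P_positions R_Wythoff q -> t' = t) ->
  P_positions (R_Wythoff_forbidding T) <> P_positions R_Wythoff.
Proof.
move=> Tt Np uniq_t eqP; move: Np; rewrite -eqP.
move=> /contrapT W; have [q [t' NTt' mv] Pq] := can_force_win_move _ _ _ W.
by apply: NTt'; rewrite (uniq_t t' q mv) // -eqP.
Qed.

(** The empty pile blocks D-moves, and [(0, k - l)] is a P-position only for [l = k]. *)
Lemma unique_L_type (k : posint) t q :
  move_of_type t (position_of 0 (val k)) q -> P_positions R_Wythoff q ->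
  t = L_type k.
Proof.
move=> mv Pq; have k0 : 0 < val k := valP k.
have [[l [-> lk Eq]]|[l [_ l0 _]]] := move_of_typeP _ _ _ _ (leq0n _) mv.
  congr L_type; apply: val_inj; apply/eqP; rewrite eqn_leq lk /= -subn_eq0.
  by case: posnP => // /not_losing0n []; rewrite /losing -Eq.
by have l_gt0 : 0 < val l := valP l; lia.
Qed.

(** The last hypothesis on [c] excludes L-moves; the targets of two different D-moves are themselves
    joined by a D-move, so they are not both P-positions. *)
Lemma unique_D_type (k : posint) a b t q : a <= b -> losing a b ->
  (forall c, c < b + val k -> ~ losing (a + val k) c) ->
  move_of_type t (position_of (a + val k) (b + val k)) q ->
  P_positions R_Wythoff q -> t = D_type k.
Proof.
move=> ab Pab noL mv Pq; have k0 : 0 < val k := valP k.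
have le_ab : a + val k <= b + val k by lia.
have [[l [_ ly Eq]]|[l [-> lx Eq]]] := move_of_typeP _ _ _ _ le_ab mv;
  have l0 : 0 < val l := valP l.
  by case: (noL (b + val k - val l)); [lia | rewrite /losing -Eq].
have Pq' : losing (a + val k - val l) (b + val k - val l) by rewrite /losing -Eq.
congr D_type; apply: val_inj; have [lk|kl|//] := ltngtP (val l) (val k).
  have [Ea Eb] : a + (val k - val l) = a + val k - val l /\
    b + (val k - val l) = b + val k - val l by lia.
  by case: (losing_D a b (val k - val l) _ _ Pab); [lia | rewrite Ea Eb].
have [Ea Eb] : a + val k - val l + (val l - val k) = a /\
  b + val k - val l + (val l - val k) = b by lia.
by case: (losing_D _ _ (val l - val k) _ _ Pq'); [lia | rewrite Ea Eb].
Qed.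

Lemma forbidding_D_neq (T : set move_type) (k : posint) a b :
  T (D_type k) -> a <= b -> losing a b ->
  (forall c, c < b + val k -> ~ losing (a + val k) c) ->
  P_positions (R_Wythoff_forbidding T) <> P_positions R_Wythoff.
Proof.
move=> Tk ab Pab noL.
apply: (forbidding_neq _ _ (position_of (a + val k) (b + val k)) Tk).
  by move=> /(losing_D _ _ _ (valP k)).
by move=> t q; exact: unique_D_type.
Qed.

Theorem theorem2p3 (T : set move_type) (hT : T !=set0) :
  P_positions (R_Wythoff_forbidding T) <> P_positions R_Wythoff.
Proof.
case: hT => -[] k Tk; have k0 : 0 < val k := valP k.
  apply: (forbidding_neq _ _ (position_of 0 (val k)) Tk).
    exact: not_losing0n.
  exact: unique_L_type.
(* The pairs [(i, k)] with [i < k] are exactly the L-options of [(k, k)]. *)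
have [[i ik Pik]|noL] := pselect (exists2 i, i < val k & losing i (val k)).
  apply: (forbidding_D_neq _ _ 1 2 Tk isT losing12) => c c_lt Pc.
  (* For [c <= k], the larger piles of [(i, k)] and [(c, k + 1)] are consecutive; otherwise
     [c = k + 1] and the piles are equal. *)
  have [ck|ck|ck] := ltngtP c (val k).
  - by apply: (losing_larger_succ i c (val k)) => //; [lia | lia | exact: losingC].
  - have Ec : c = 1 + val k by lia.
    by apply: not_losingnn (1 + val k) _ _; rewrite -?{2}Ec.
  - by apply: (losing_larger_succ i (val k) (val k)) => //;
      [lia | rewrite -{1}ck; exact: losingC].
apply: (forbidding_D_neq _ _ 0 0 Tk isT losing00) => c c_lt Pc.
by apply: noL; exists c => //; exact: losingC.
Qed.
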